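(* Let $(X,\mathfrak{V})$ be an iterated function system with the small-boundary property (SBP). Then $\mathrm{mdim}(X,\mathfrak{V})=0$, where $\mathrm{mdim}$ denotes the mean dimension.
   Context: Iterated function system: $X$ is a compact metric space with metric $d$, and $\mathfrak V$ is a (possibly infinite) family of homeomorphisms $v:D(v)\to v(D(v))\subset X$ with closed domain $D(v)\subset X$. The pair $(X,\mathfrak V)$ is an iterated function system (IFS) if there is a set $O\subset X$ with $\emptyset\neq\bigcup_{v\in\mathfrak V}v(D(v)\cap O)\subset\bigcup_{v\in\mathfrak V}(D(v)\cap O)$. Orbits: $\mathbb N=\{1,2,\dots\}$, $\Sigma=\mathfrak V^{\mathbb N}$ is the set of sequences $\sigma=(v_1,v_2,\dots)$ with $v_i\in\mathfrak V$. For $\sigma\in\Sigma$ and $x\in X$, $v^{\sigma(n)}(x)=v_n\circ\cdots\circ v_1(x)$ whenever well defined, $v^{\sigma(0)}(x)=x$. $\Sigma_x=\{\sigma\in\Sigma: v^{\sigma(n)}(x)\text{ is well defined for all }n\in\mathbb N\}$ and $\Sigma_\sigma=\{x\in X: v^{\sigma(n)}(x)\text{ is well defined for all }n\in\mathbb N\}$ (a closed subset of $X$, possibly empty). Small-boundary property: for $A\subset X$, $n>0$ and $x\in A$ (and, in the formula for $\mathrm{ocap}$, $x\in X$), $\mathrm{cap}(n,x,A)=\sup_{\sigma\in\Sigma_x}\frac1n\sum_{i=0}^{n-1}1_A(v^{\sigma(i)}(x))$ (with value $0$ if $\Sigma_x=\emptyset$), and the orbit capacity of $A$ is $\mathrm{ocap}(A)=\lim_{n\to\infty}\sup_{x\in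 X}\mathrm{cap}(n,x,A)$. $A$ is small if $\mathrm{ocap}(A)=0$. $(X,\mathfrak V)$ has the SBP if for each $x\in X$ and each open neighborhood $U$ of $x$ there is an open set $V\subset U$ with $x\in V$ whose boundary $\partial V$ is small. Mean dimension: for covers $\alpha,\beta$ of a set, $\beta\succ\alpha$ ($\beta$ refines $\alpha$) means every $U\in\beta$ is contained in some $V\in\alpha$. For a nonempty closed $A\subset X$ and an open cover $\alpha$ of $A$, $\mathrm{ord}(\alpha,A)=\max_{x\in A}\sum_{U\in\alpha}1_U(x)-1$ and $\mathcal D(\alpha)=\min_{\beta\succ\alpha}\mathrm{ord}(\beta,A)$, with $\beta$ ranging over finite open covers of $A$ refining $\alpha$. For an open cover $\alpha$ of $X$ and $\sigma\in\Sigma$, $\alpha_0^{n-1}(\sigma)$ is the open cover of $\Sigma_\sigma$ (as a space with the relative topology) consisting of all sets $\bigcap_{i=0}^{n-1}\{x\in\Sigma_\sigma: v^{\sigma(i)}(x)\in U_i\}$ with $U_0,\dots,U_{n-1}\in\alpha$. With $\mathcal U_X$ the set of finite open covers of $X$, $$\mathrm{mdim}(X,\mathfrak V,\sigma)=\sup_{\alpha\in\mathcal U_X}\limsup_{n\to\infty}\frac{\mathcal D(\alpha_0^{n-1}(\sigma))}{n},\qquad \mathrm{mdim}(X,\mathfrak V)=\sup_{\sigma\in\Sigma}\mathrm{mdim}(X,\mathfrak V,\sigma),$$ with the convention $\mathrm{mdim}(X,\mathfrak V,\sigma)=0$ if $\Sigma_\sigma=\emptyset$. *)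

(* Defs.v *)
From HB Require Import structures.
From mathcomp Require Import all_boot all_order all_algebra.
From mathcomp Require Import all_classical all_reals all_analysis.

Set Implicit Arguments.
Unset Strict Implicit.
Unset Printing Implicit Defensive.

Import Order.TTheory GRing.Theory Num.Theory.
Import numFieldNormedType.Exports.

Local Open Scope classical_set_scope.
Local Open Scope ring_scope.

(* A homeomorphism of a closed set D onto its image; [pmap] and [pinv] are
   total functions whose values off D and off [pmap @` D] are irrelevant.
   D may be empty. *)
Record partial_homeo (X : topologicalType) := PartialHomeo {
  dom : set X;
  pmap :> X -> X;
  pinv : X -> X;
  closed_dom : closed dom;
  pmapK : {in dom, cancel pmap pinv};
  pmap_continuous : {within dom, continuous pmap};
  pinv_continuous : {within pmap @` dom, continuous pinv}
}.

Definition is_ifs (X : topologicalType) (I : Type)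
    (v : I -> partial_homeo X) : Prop :=
  exists O : set X,
    \bigcup_(i in [set: I]) v i @` (dom (v i) `&` O) !=set0 /\
    \bigcup_(i in [set: I]) v i @` (dom (v i) `&` O) `<=`
      \bigcup_(i in [set: I]) (dom (v i) `&` O).

(* Sequences of maps are indexed from 0: [sigma k] stands for v_(k+1). *)
Fixpoint orbit (X : topologicalType) (I : Type) (v : I -> partial_homeo X)
    (sigma : nat -> I) (n : nat) (x : X) : X :=
  if n is k.+1 then v (sigma k) (orbit v sigma k x) else x.

Definition orbit_defined (X : topologicalType) (I : Type)
    (v : I -> partial_homeo X) (sigma : nat -> I) (n : nat) (x : X) : Prop :=
  forall k, (k < n)%N -> dom (v (sigma k)) (orbit v sigma k x).

Definition Sigma_at (X : topologicalType) (I : Type)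
    (v : I -> partial_homeo X) (x : X) : set (nat -> I) :=
  [set sigma | forall n, orbit_defined v sigma n x].

Definition Sigma_dom (X : topologicalType) (I : Type)
    (v : I -> partial_homeo X) (sigma : nat -> I) : set X :=
  [set x | forall n, orbit_defined v sigma n x].

Section small_boundary.
Context {R : realType} {X : metricType R} {I : Type}.
Variable v : I -> partial_homeo X.

(* The real supremum of the empty set is 0 ([sup0]), so [cap n x A = 0] when
   [Sigma_at v x] is empty. *)
Definition cap (n : nat) (x : X) (A : set X) : R :=
  sup [set n%:R^-1 * \sum_(i < n) \1_A (orbit v sigma i x)
      | sigma in Sigma_at v x].

Definition sup_cap (A : set X) (n : nat) : R :=
  sup [set cap n x A | x in [set: X]].

(* The limit exists: see [is_cvg_sup_cap]. *)
Definition ocap (A : set X) : R := limn (sup_cap A).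

Definition small (A : set X) : Prop := ocap A = 0.

Definition boundary (A : set X) : set X := closure A `\` interior A.

Definition has_SBP : Prop :=
  forall (x : X) (U : set X), open U -> U x ->
    exists V : set X, [/\ open V, V `<=` U, V x & small (boundary V)].

Let hits (A : set X) (sigma : nat -> I) (n : nat) (x : X) : R :=
  \sum_(i < n) \1_A (orbit v sigma i x).

Let hits_bound A sigma n x : 0 <= hits A sigma n x <= n%:R.
Proof.
apply/andP; split; first exact: sumr_ge0.
rewrite -[X in _ <= X%:R]card_ord -sum1_card natr_sum.
by apply: ler_sum => i _; rewrite indicE; case: (_ \in _).
Qed.

Let orbitD sigma m n x :
  orbit v sigma (m + n) x = orbit v (fun k => sigma (m + k)%N) n (orbit v sigma m x).
Proof. by elim: n => [|n IH]; rewrite ?addn0// addnS /= IH. Qed.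

Let hitsD A sigma m n x : hits A sigma (m + n) x =
  hits A sigma m x + hits A (fun k => sigma (m + k)%N) n (orbit v sigma m x).
Proof.
rewrite /hits big_split_ord /=; congr (_ + _).
by apply: eq_bigr => i _; rewrite orbitD.
Qed.

Let Sigma_at_shift sigma m x : Sigma_at v x sigma ->
  Sigma_at v (orbit v sigma m x) (fun k => sigma (m + k)%N).
Proof. by move=> h n k kn; rewrite -orbitD; exact: (h (m + k).+1). Qed.

Let avg_le1 A sigma n x : n%:R^-1 * hits A sigma n x <= 1.
Proof.
case: n => [|n]; first by rewrite invr0 mul0r.
by rewrite mulrC ler_pdivrMr// mul1r; case/andP: (hits_bound A sigma n.+1 x).
Qed.

Let cap_ub A sigma n x : Sigma_at v x sigma ->
  n%:R^-1 * hits A sigma n x <= cap n x A.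
Proof.
move=> h; apply: ub_le_sup; last by exists sigma.
by exists 1 => _ [s _ <-]; exact: avg_le1.
Qed.

Let cap_le A n x c : 0 <= c ->
  (forall sigma, Sigma_at v x sigma -> n%:R^-1 * hits A sigma n x <= c) ->
  cap n x A <= c.
Proof.
move=> c0 h; rewrite /cap; set E := (X in sup X).
have [->|/set0P E0] := eqVneq E set0; first by rewrite sup0.
by apply: ge_sup => // _ [s sx <-]; exact: h.
Qed.

Let sup_cap_ub A sigma n x : Sigma_at v x sigma ->
  hits A sigma n x <= n%:R * sup_cap A n.
Proof.
case: n => [|n] h; first by rewrite /hits big_ord0 mul0r.
rewrite -ler_pdivrMl//; apply: (le_trans (cap_ub A n.+1 h)).
apply: ub_le_sup; last by exists x.
by exists 1 => _ [y _ <-]; apply: cap_le => // s _; exact: avg_le1.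
Qed.

Let sup_cap_le A n c : 0 <= c ->
  (forall x sigma, Sigma_at v x sigma -> n%:R^-1 * hits A sigma n x <= c) ->
  sup_cap A n <= c.
Proof.
move=> c0 h; rewrite /sup_cap; set E := (X in sup X).
have [->|/set0P E0] := eqVneq E set0; first by rewrite sup0.
by apply: ge_sup => // _ [x _ <-]; apply: cap_le => // s; exact: h.
Qed.

Let sup_ge0 (E : set R) : (forall y, E y -> 0 <= y) -> 0 <= sup E.
Proof.
move=> h; have [[[y Ey] ubE]|/sup_out ->//] := pselect (has_sup E).
exact: le_trans (h _ Ey) (ub_le_sup ubE Ey).
Qed.

Let sup_cap_ge0 A n : 0 <= sup_cap A n.
Proof.
apply: sup_ge0 => _ [x _ <-]; apply: sup_ge0 => _ [s _ <-].
by rewrite mulr_ge0 ?invr_ge0//; case/andP: (hits_bound A s n x).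
Qed.

Let hits_block A N q r sigma x : Sigma_at v x sigma ->
  hits A sigma (q * N + r) x <= q%:R * (N%:R * sup_cap A N) + r%:R.
Proof.
elim: q sigma x => [|q IH] sigma x h.
  by rewrite !mul0n add0n mul0r add0r; case/andP: (hits_bound A sigma r x).
rewrite mulSn -addnA hitsD -natr1 mulrDl mul1r [X in _ <= X + _]addrC -addrA.
by rewrite lerD// ?sup_cap_ub// IH//; exact: Sigma_at_shift.
Qed.

(* Fekete's argument, from the subadditivity of n * sup_cap A n. *)
Let sup_cap_block A N n : (0 < N)%N -> (0 < n)%N ->
  sup_cap A n <= sup_cap A N + N%:R / n%:R.
Proof.
move=> N0 n0; apply: sup_cap_le => [|x sigma h].
  by rewrite addr_ge0// ?sup_cap_ge0// divr_ge0.
rewrite mulrC ler_pdivrMr ?ltr0n// mulrDl -mulrA mulVf ?mulr1 ?pnatr_eq0 -?lt0n//.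
rewrite {1}(divn_eq n N); apply: (le_trans (hits_block A _ _ _ h)).
rewrite mulrA -natrM mulrC lerD ?ler_wpM2l ?sup_cap_ge0 ?ler_nat//.
  exact: leq_divM.
by rewrite ltnW// ltn_pmod.
Qed.

Lemma is_cvg_sup_cap (A : set X) : cvgn (sup_cap A).
Proof.
pose E := [set sup_cap A n.+1 | n in [set: nat]].
have Einf : has_inf E.
  split; first by exists (sup_cap A 1), 0%N.
  by exists 0 => _ [n _ <-]; exact: sup_cap_ge0.
apply/cvg_ex; exists (inf E); apply/cvgrPdist_le => e e0.
have e20 : 0 < e / 2 by rewrite divr_gt0.
have [_ [N _ <-] hN] := inf_adherent e20 Einf.
near=> n.
have n0 : (0 < n)%N by near: n; exact: nbhs_infty_gt.
have le1 : inf E <= sup_cap A n.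
  by apply: ge_inf; [case: Einf | exists n.-1; rewrite ?prednK].
have le2 : N.+1%:R / n%:R <= e / 2.
  rewrite ler_pdivrMr ?ltr0n// -ler_pdivrMl//.
  by near: n; exact: nbhs_infty_ger.
rewrite distrC ger0_norm ?subr_ge0// lerBlDl.
apply: (le_trans (@sup_cap_block A N.+1 n _ n0)) => //.
by rewrite (le_trans (lerD (ltW hN) le2))// -addrA -splitr.
Unshelve. all: by end_near. Qed.

End small_boundary.

Section mean_dimension.
Context {R : realType} {X : metricType R} {I : Type}.

(* The elements of an open cover of A are subsets of A which are open in the
   relative topology.  In [subspace A] the points off A are isolated, hence
   the condition [U `<=` A]. *)
Definition open_cover (A : set X) (alpha : set (set X)) : Prop :=
  (forall U, alpha U -> U `<=` A /\ open (U : set (subspace A))) /\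
  \bigcup_(U in alpha) U = A.

Definition finite_open_cover (A : set X) (alpha : set (set X)) : Prop :=
  finite_set alpha /\ open_cover A alpha.

Definition refines (beta alpha : set (set X)) : Prop :=
  forall U, beta U -> exists2 V, alpha V & U `<=` V.

Local Open Scope ereal_scope.

(* For a nonempty A and a finite cover alpha the supremum is a maximum; the sum
   is only meaningful for a finite alpha. *)
Definition ord (alpha : set (set X)) (A : set X) : \bar R :=
  ereal_sup [set (\sum_(U \in alpha) (\1_U x : R))%R%:E | x in A] - 1.

(* The infimum is a minimum, [ord beta A] being an integer. *)
Definition cover_dim (A : set X) (alpha : set (set X)) : \bar R :=
  ereal_inf [set ord beta A
            | beta in [set beta | finite_open_cover A beta /\
                                  refines beta alpha]].

Variable v : I -> partial_homeo X.

(* The cover alpha_0^(n-1)(sigma) of [Sigma_dom v sigma]. *)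
Definition orbit_cover (sigma : nat -> I) (n : nat) (alpha : set (set X)) :
    set (set X) :=
  [set Sigma_dom v sigma `&`
         \bigcap_(i in [set: 'I_n]) (orbit v sigma i @^-1` U i)
  | U in [set U : 'I_n -> set X | forall i, alpha (U i)]].

Definition mdim_along (sigma : nat -> I) : \bar R :=
  if Sigma_dom v sigma == set0 then 0
  else ereal_sup
    [set limn_esup (fun n =>
           cover_dim (Sigma_dom v sigma) (orbit_cover sigma n alpha) *
           (n%:R^-1)%:E)
    | alpha in [set alpha | finite_open_cover [set: X] alpha]].

Definition mdim : \bar R :=
  ereal_sup [set mdim_along sigma | sigma in [set: nat -> I]].

End mean_dimension.

(* Main.v *)
From Pilot Require Import Defs.
From mathcomp Require Import all_boot all_order all_algebra finmap.
From mathcomp Require Import all_classical all_reals all_analysis.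
(* [all_boot] shadows [orbit] and [ord]. *)
Import Pilot.Defs.

Import Order.TTheory GRing.Theory Num.Theory.
Import numFieldNormedType.Exports.

Local Open Scope classical_set_scope.
Local Open Scope ring_scope.

(* Fix sigma and put A = Sigma_sigma, a compact set.  Refine the given cover of
   X to a finite open cover V_0, ..., V_(m-1) with small boundaries and choose
   continuous h_k >= 0 with V_k = {h_k > 0}.  For J : 'I_n -> 'I_m let O_J be
   the set of x in A for which some t in ]0, delta[ satisfies, for all i < n:
   J i is the first k with h_k (v^i x) > t, and the values h_k (v^i x), k < J i,
   all are < t.  These open sets refine alpha_0^(n-1), and for small delta they
   cover A.  Along a fixed x the index J depends on t only through the number of
   values h_k (v^i x) below t, so x lies in at most 1 + N sets O_J, where N is
   the number of pairs (i, k) with 0 < h_k (v^i x) < delta.  By compactness, for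
   delta small (depending on n) N is at most the number of visits of some orbit
   to the boundaries, hence at most n times the sum of their capacities at time
   n, and this is o(n).  Unlike in the classical proof, no neighbourhood of the
   boundaries with small capacity uniformly in n is needed. *)

(** * Continuity and closedness relative to a subset *)

Lemma within_continuous_comp_within (S T U : topologicalType)
    (A : set S) (B : set T) (f : S -> T) (g : T -> U) :
  (forall x, A x -> B (f x)) ->
  {within A, continuous f} -> {within B, continuous g} ->
  {within A, continuous (g \o f)}.
Proof.
move=> AB /subspace_continuousP cf /subspace_continuousP cg.
apply/subspace_continuousP => x Ax.
apply: (cvg_comp _ _ _ (cg _ (AB _ Ax))).
move=> P /(cf x Ax); rewrite /= !nbhs_simpl /within /=.
by apply: filterS => y /= h Ay; apply: h => //; exact: AB.
Qed.

Lemma closed_within_preimage (S T : topologicalType) (A : set S) (B : set T)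
    (f : S -> T) :
  closed A -> closed B -> {within A, continuous f} ->
  closed (A `&` f @^-1` B).
Proof.
move=> cA cB /continuous_closedP /(_ _ cB) h.
by rewrite (closed_setSI (f @^-1` B) cA).
Qed.

(** * Domains and continuity of the iterates *)

Section orbits.
Context {X : topologicalType} {I : Type} (v : I -> partial_homeo X).
Variable sigma : nat -> I.

Let orbit_definedS n :
  [set x | orbit_defined v sigma n.+1 x] =
  [set x | orbit_defined v sigma n x] `&`
    orbit v sigma n @^-1` dom (v (sigma n)).
Proof.
apply/seteqP; split=> x /= => [h|[h hn] k].
  by split=> [k kn|]; apply: h => //; rewrite ltnS ltnW.
rewrite ltnS leq_eqVlt => /orP[/eqP -> //|]; exact: h.
Qed.

(** One induction carries both claims: the next domain is cut out by the preimage of a closed [dom]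
    under the current iterate, so its closedness relies on continuity. *)
Lemma orbit_defined_closed_continuous n :
  closed [set x | orbit_defined v sigma n x] /\
  {within [set x | orbit_defined v sigma n x], continuous (orbit v sigma n)}.
Proof.
elim: n => [|n [cl ct]].
  split; last by move=> x; apply: continuous_subspaceT => y; exact: cvg_id.
  by rewrite (_ : [set _ | _] = setT) ?predeqE//; exact: closedT.
split.
  rewrite orbit_definedS; apply: closed_within_preimage => //.
  exact: closed_dom.
apply: (@within_continuous_comp_within _ _ _ _ (dom (v (sigma n)))
  (orbit v sigma n) (v (sigma n))).
- by move=> x; apply.
- by apply: continuous_subspaceW ct; rewrite orbit_definedS; exact: subIsetl.
- exact: pmap_continuous.
Qed.

Lemma closed_Sigma_dom : closed (Sigma_dom v sigma).
Proof.
have -> : Sigma_dom v sigma =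
    \bigcap_n [set x | orbit_defined v sigma n x].
  by apply/seteqP; split=> x h n; [move=> _|]; exact: h.
by apply: closed_bigI => n _; case: (orbit_defined_closed_continuous n).
Qed.

Lemma orbit_continuous n :
  {within Sigma_dom v sigma, continuous (orbit v sigma n)}.
Proof.
case: (orbit_defined_closed_continuous n) => _.
by apply: continuous_subspaceW => x; exact.
Qed.

End orbits.

(** * Cozero functions and multiplicity bounds *)

Lemma open_cozero (R : realType) (X : metricType R) (V : set X) : open V ->
  exists h : X -> R,
    [/\ continuous h, forall x, V x -> 0 < h x & forall x, ~ V x -> h x = 0].
Proof.
move=> oV.
(* [inf (E x)] is the distance to the complement of [V] capped at 1, a 1-Lipschitz function of [x].
   The 1 keeps [E x] nonempty when [V] is the whole space. *)
pose E x := [set mdist x y | y in ~` V] `|` [set 1 : R].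
have E1 x : E x 1 by right.
have E0 x : lbound (E x) 0.
  by move=> _ [[y _ <-]|->] //; exact: mdist_ge0.
have Einf x : has_inf (E x) by split; [exists 1 | exists 0].
have tri x z : inf (E x) <= mdist x z + inf (E z).
  rewrite -lerBlDl; apply: lb_le_inf; first by exists 1.
  move=> _ [[y nVy <-]|->]; rewrite lerBlDl.
    apply: le_trans (metric_triangle _ _ _).
    by apply: ge_inf; [case: (Einf x) | left; exists y].
  apply: (@le_trans _ _ 1); last by rewrite lerDr mdist_ge0.
  by apply: ge_inf; [case: (Einf x) | ].
exists (fun x => inf (E x)); split.
- move=> x; apply/cvgrPdist_lt => e e0.
  near=> z.
  have xz : mdist x z < e.
    by near: z; apply/metricType_numDomainType.nbhs_mdistP; exists e.
  apply: le_lt_trans xz; rewrite /= ler_norml lerBlDr tri andbT.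
  by rewrite lerBrDr addrC lerBlDl metric_sym tri.
- move=> x Vx.
  have : nbhs x V by exact: open_nbhs_nbhs.
  move=> /metricType_numDomainType.nbhs_mdistP[e /= e0 eV].
  apply: (@lt_le_trans _ _ (Order.min e 1)); first by rewrite lt_min e0 ltr01.
  apply: lb_le_inf; first by exists 1.
  move=> _ [[y nVy <-]|->]; rewrite ge_min ?lexx ?orbT//.
  by rewrite leNgt; apply/orP; left; apply/negP => /eV.
- move=> x nVx; apply/eqP; rewrite eq_le; apply/andP; split.
    by apply: ge_inf; [case: (Einf x) | left; exists x => //; exact: mdistxx].
  by apply: lb_le_inf; [exists 1 | exact: E0].
Unshelve. all: by end_near. Qed.

(** Each member through [x] gets a label below [N], and a label determines its set. A relation is
    used because one set may admit several labels. *)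
Lemma fsum_indic_le (R : realType) (T : Type) (beta : set (set T)) (x : T)
    (N : nat) (rel : set T -> nat -> Prop) : finite_set beta ->
  (forall U, beta U -> U x -> exists2 c, (c < N)%N & rel U c) ->
  (forall U U' c, rel U c -> rel U' c -> U = U') ->
  \sum_(U \in beta) (\1_U x : R) <= N%:R.
Proof.
move=> fb hc inj_rel.
have /choice[c hcU] : forall U, exists c, beta U -> U x -> (c < N)%N /\ rel U c.
  move=> U; have [bU|nbU] := pselect (beta U /\ U x).
    by have [c cN rc] := hc _ bU.1 bU.2; exists c.
  by exists 0 => bU Ux; case: nbU.
rewrite fsbig_finite//=.
have -> : \sum_(U <- fset_set beta) (\1_U x : R) =
    (size [seq U <- fset_set beta | `[< U x >]])%:R.
  rewrite size_filter -sum1_count [in RHS]big_mkcond natr_sum.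
  apply: eq_bigr => U _; rewrite indicE.
  by case: asboolP => Ux; [rewrite mem_set | rewrite memNset].
rewrite ler_nat -(size_map c) -(size_iota 0 N).
have mf U : U \in [seq U <- fset_set beta | `[< U x >]] -> beta U /\ U x.
  by rewrite mem_filter in_fset_set// => /andP[/asboolP Ux /set_mem bU].
apply: uniq_leq_size.
  rewrite map_inj_in_uniq ?filter_uniq ?fset_uniq//.
  move=> U U' /mf[bU Ux] /mf[bU' Ux'] e.
  apply: (inj_rel _ _ (c U)); first exact: (hcU _ bU Ux).2.
  by rewrite e; exact: (hcU _ bU' Ux').2.
move=> _ /mapP[U /mf[bU Ux] ->]; rewrite mem_iota /=.
exact: (hcU _ bU Ux).1.
Qed.

(** * Covers by level sets *)

Lemma open_subspace_near (T : topologicalType) (A U : set T) : U `<=` A ->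
  (forall x, U x -> \forall y \near within A (nbhs x), U y) ->
  open (U : set (subspace A)).
Proof.
move=> UA hU; rewrite openE => x Ux; have := hU _ Ux; rewrite /interior.
by case: _ / (nbhs_subspaceP A x) => // nAx; case: nAx; exact: UA.
Qed.

(** Static core of the argument: [g i k] stands for [h_k] along the i-th iterate. The number of
    positive values below the level [t] will label the sets [O J] through a point. *)
Lemma cover_dim_level_sets (R : realType) (X : metricType R) (A : set X)
    (alpha : set (set X)) (n m : nat) (g : 'I_n -> 'I_m -> X -> R)
    (delta d : R) :
  0 < delta ->
  (forall i k, {within A, continuous (g i k)}) ->
  (forall x i, A x -> exists k, delta <= g i k x) ->
  (forall J : 'I_n -> 'I_m, exists2 U, alpha U &
     A `&` [set x | forall i, 0 < g i (J i) x] `<=` U) ->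
  (forall x, A x ->
     #|[pred p : 'I_n * 'I_m | 0 < g p.1 p.2 x < delta]|%:R <= d) ->
  (cover_dim A alpha <= d%:E)%E.
Proof.
move=> delta0 cg gdelta galpha count_le.
(* Both inequalities against [t] are strict, so the same [t] serves all nearby points of [A]; this
   makes [O J] open. *)
pose P (J : {ffun 'I_n -> 'I_m}) (t : R) x := [/\ A x, 0 < t < delta &
  forall i, t < g i (J i) x /\ forall k : 'I_m, (k < J i)%N -> g i k x < t].
pose O J := [set x | exists t, P J t x].
pose beta := O @` [set: {ffun 'I_n -> 'I_m}].
pose level x (t : R) := #|[pred p : 'I_n * 'I_m | 0 < g p.1 p.2 x < t]|.
have finbeta : finite_set beta by apply: finite_image; exact: finite_finset.
have cover_beta : \bigcup_(U in beta) U = A.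
  apply/seteqP; split=> [x [_ [J _ <-]] [t []]//|x Ax].
  (* With [t] below every positive value at [x], no value equals [t]; hence all values before the
     first one above [t] are strictly below it. *)
  have [t [t0 td ht]] : exists t, [/\ 0 < t, t < delta &
      forall i k, 0 < g i k x -> t < g i k x].
    have h : \forall t \near 0^'+, forall p : 'I_n * 'I_m,
        0 < g p.1 p.2 x -> t < g p.1 p.2 x.
      apply: filter_forall => p; have [gp|gp] := ltP 0 (g p.1 p.2 x).
        by apply: filterS (nbhs_right_lt gp) => t.
      by apply: nearW.
    near (0 : R)^'+ => t; exists t.
    split; [by []|by near: t; exact: nbhs_right_lt|].
    move=> i k.
    have : forall p : 'I_n * 'I_m, 0 < g p.1 p.2 x -> t < g p.1 p.2 x.
      by near: t.
    by move=> /(_ (i, k)).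
  have firstk i : exists k, t < g i k x /\
      forall l : 'I_m, (l < k)%N -> g i l x < t.
    have [k0 gk0] := gdelta x i Ax.
    have Pk0 : t < g i k0 x by exact: lt_le_trans gk0.
    exists [arg min_(k < k0 | (t < g i k x)%R) nat_of_ord k]%N.
    case: arg_minnP => // k gk mink.
    split=> // l lk; rewrite lt_neqAle; apply/andP; split.
      apply/eqP => e; have := ht i l; rewrite e ltxx.
      by move=> /(_ t0).
    by rewrite leNgt; apply/negP => /mink; rewrite leqNgt lk.
  have [J hJ] := choice firstk.
  exists (O [ffun i => J i]); first by exists [ffun i => J i].
  exists t; split=> //; first by rewrite t0.
  by move=> i; rewrite ffunE; split; [exact: (hJ i).1|exact: (hJ i).2].
have openO J : open (O J : set (subspace A)).
  apply: open_subspace_near => [x [t []]//|x [t [Ax tP h]]].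
  have gi i k := (subspace_continuousP A (g i k)).1 (cg i k) x Ax.
  have h1 : \forall y \near within A (nbhs x), forall i, t < g i (J i) y.
    by apply: filter_forall => i; exact: cvgr_gt (gi i (J i)) _ (h i).1.
  have h2 : \forall y \near within A (nbhs x),
      forall p : 'I_n * 'I_m, (p.2 < J p.1)%N -> g p.1 p.2 y < t.
    apply: filter_forall => p; have [pJ|pJ] := ltnP p.2 (J p.1); last first.
      by apply: nearW.
    by apply: filterS (cvgr_lt _ (gi p.1 p.2) _ ((h p.1).2 _ pJ)) => y.
  near=> y; exists t; split=> //.
    by near: y; exact: withinT.
  move=> i; split.
    by move: i; near: y.
  move=> k kJ.
  have : forall p : 'I_n * 'I_m, (p.2 < J p.1)%N -> g p.1 p.2 y < t.
    by near: y.
  by move=> /(_ (i, k)); exact.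
apply: (@le_trans _ _ (ord beta A)).
  apply: ereal_inf_lbound; exists beta => //; split.
    split=> //; split=> // _ [J _ <-]; split; last exact: openO.
    by move=> x [t []].
  move=> _ [J _ <-]; have [U aU JU] := galpha J; exists U => //.
  move=> x [t [Ax /andP[t0 _] h]]; apply: JU; split=> // i.
  exact: lt_trans t0 (h i).1.
rewrite /ord leeBlDr//; apply: ge_ereal_sup => _ [x Ax <-].
rewrite -EFinD lee_fin.
apply: (@le_trans _ _ (level x delta).+1%:R); last first.
  by rewrite -natr1 lerD2r; exact: count_le.
(* The label [level x t] is at most [level x delta]; the value 0 is possible, hence the
   successor. *)
apply: (@fsum_indic_le _ _ _ _ _ (fun U c =>
  exists J t, [/\ U = O J, P J t x & c = level x t])) => //.
  move=> _ [J _ <-] [t Pt]; exists (level x t); last by exists J, t.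
  rewrite ltnS; apply: subset_leq_card; apply/fintype.subsetP => p.
  rewrite !inE => /andP[-> gt]; case: Pt => _ /andP[_ td] _.
  exact: lt_trans td.
move=> U U' c [J [t [-> Pt ->]]] [J' [t' [-> Pt']]] ltt'.
suff -> : J = J' by [].
wlog tt' : J J' t t' Pt Pt' ltt' / t <= t'.
  move=> hw; have [tt'|tt'] := leP t t'; first exact: (hw J J' t t').
  by apply/esym; apply: (hw J' J t' t) => //; exact: ltW.
(* Nested sets of equal cardinality coincide, so no positive value lies in [t, t'[ and both levels
   select the same first index. *)
have sub : [pred p : 'I_n * 'I_m | 0 < g p.1 p.2 x < t] \subset
    [pred p : 'I_n * 'I_m | 0 < g p.1 p.2 x < t'].
  apply/fintype.subsetP => p; rewrite !inE => /andP[-> /lt_le_trans]; exact.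
case: Pt => _ /andP[t0 td] hJ; case: Pt' => _ /andP[t'0 t'd] hJ'.
have same i k : g i k x < t' -> g i k x < t.
  have [g0|g0] := ltP 0 (g i k x); last by move=> _; exact: le_lt_trans t0.
  have /(_ (i, k)) := subset_cardP ltt' sub.
  by rewrite !inE /= g0 /= => ->.
apply/ffunP => i; apply/val_inj/eqP; rewrite eqn_leq; apply/andP; split.
  rewrite leqNgt; apply/negP => /(hJ i).2; rewrite ltNge => /negP; apply.
  exact: le_trans (ltW (hJ' i).1).
rewrite leqNgt; apply/negP => /(hJ' i).2 /same; rewrite ltNge => /negP; apply.
exact: ltW (hJ i).1.
Unshelve. all: by end_near. Qed.

(** Near-covering compactness is applied to the filter of all sufficiently large finite lists: near
    [x], any list containing a [t] with [V t x] works. *)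
Lemma compact_finite_cover (X : topologicalType) (T : choiceType)
    (V : T -> set X) :
  compact [set: X] -> (forall t, open (V t)) -> (forall x, exists t, V t x) ->
  exists s : seq T, forall x, exists2 t, t \in s & V t x.
Proof.
move=> /compact_near_coveringP cX oV cV.
pose F : set_system (seq T) :=
  filter_from setT (fun s : seq T => [set s' : seq T | {subset s <= s'}]).
have FF : Filter F.
  apply: filter_from_filter; first by exists [::].
  move=> s s' _ _; exists (s ++ s') => // s'' ss''.
  by split=> t ts; apply: ss''; rewrite mem_cat ts ?orbT.
have [s _ hs] : \forall s \near F,
    [set: X] `<=` [set x | exists2 t, t \in s & V t x].
  apply: (cX _ F (fun s x => exists2 t, t \in s & V t x)) => x _.
  have [t Vtx] := cV x.
  exists (V t, [set s' : seq T | {subset [:: t] <= s'}]).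
    split=> /=; first by apply: open_nbhs_nbhs; split; [exact: oV|].
    by exists [:: t].
  move=> [y s] /= [Vty ts]; exists t => //; apply: ts; exact: mem_head.
by exists s => x; apply: (hs s).
Qed.

(** * Dimension of orbit covers against orbit capacity *)

Section orbit_capacity.
Context {R : realType} {X : metricType R} {I : Type}.
Variable v : I -> partial_homeo X.

Lemma sum_orbit_le_sup_cap (A : set X) (sigma : nat -> I) (n : nat) (x : X) :
  Sigma_dom v sigma x ->
  \sum_(i < n) (\1_A (orbit v sigma i x) : R) <= n%:R * sup_cap v A n.
Proof.
case: n => [|n] sx; first by rewrite big_ord0 mul0r.
rewrite -ler_pdivrMl ?ltr0n//.
(* These bounds make the suprema genuine: the real [sup] of an unbounded set is 0. *)
have avg_le1 s z : n.+1%:R^-1 * \sum_(i < n.+1) (\1_A (orbit v s i z) : R) <= 1.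
  rewrite mulrC ler_pdivrMr ?ltr0n// mul1r -[n.+1 in leRHS]card_ord -sum1_card.
  by rewrite natr_sum; apply: ler_sum => i _; rewrite indicE; case: (_ \in _).
have cap_le1 z : cap v n.+1 z A <= 1.
  rewrite /cap; set E := (X in sup X).
  have [->|/set0P E0] := eqVneq E set0; first by rewrite sup0.
  by apply: ge_sup => // _ [s _ <-].
apply: (@le_trans _ _ (cap v n.+1 x A)).
  apply: ub_le_sup; last by exists sigma.
  by exists 1 => _ [s _ <-].
apply: ub_le_sup; last by exists x.
by exists 1 => _ [z _ <-].
Qed.

(** Compactness provides a scale [delta] for this fixed [n]; it may depend on [n] because the final
    bound does not contain it. *)
Lemma cover_dim_orbit_cover (sigma : nat -> I) (alpha : set (set X))
    (m : nat) (V : 'I_m -> set X) (n : nat) :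
  compact [set: X] ->
  (forall k, open (V k)) -> (forall x, exists k, V k x) ->
  (forall k, exists2 U, alpha U & V k `<=` U) ->
  (cover_dim (Sigma_dom v sigma) (orbit_cover v sigma n alpha) <=
     (n%:R * \sum_(k < m) sup_cap v (boundary (V k)) n)%:E)%E.
Proof.
move=> cX oV cV subV; set A := Sigma_dom v sigma.
have cA : compact A.
  by apply: (subclosed_compact _ cX) => //; exact: closed_Sigma_dom.
pose f (i : 'I_n) := orbit v sigma i.
have cf i : {within A, continuous (f i)} by exact: orbit_continuous.
have [h hP] := choice (fun k => @open_cozero R X (V k) (oV k)).
have near_cover : \forall delta \near (0 : R)^'+,
    [set: X] `<=` [set x | exists k, delta <= h k x].
  move/compact_near_coveringP : (cX); apply => x _.
  have [k Vkx] := cV x; have [ch h0 _] := hP k.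
  have h2 : 0 < h k x / 2 by rewrite divr_gt0// h0.
  have h2x : h k x / 2 < h k x by rewrite ltr_pdivrMr// ltr_pMr ?h0// ltr1n.
  near=> y delta; exists k; apply: (@le_trans _ _ (h k x / 2)) => /=.
    by near: delta; apply: filterS (nbhs_right_lt h2) => d /ltW.
  by near: y; apply: filterS (cvgr_gt _ (ch x) _ h2x) => z /ltW.
(* The comparison point [x] visits the boundaries at every pair where [y] comes within [delta].
   Locally, if [f i x] is in [V k], then [h k] stays above half its value; if it is off the closure,
   [h k] vanishes nearby. The premise [A y] is there because [f i] is continuous only relative to
   [A]. *)
have near_boundary : \forall delta \near (0 : R)^'+, A `<=` [set y | A y ->
    exists2 x, A x & forall (i : 'I_n) (k : 'I_m),
      0 < h k (f i y) < delta -> boundary (V k) (f i x)].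
  move/compact_near_coveringP : (cA); apply => x Ax.
  suff H (p : 'I_n * 'I_m) : \forall y \near x & delta \near (0 : R)^'+,
      A y -> 0 < h p.2 (f p.1 y) < delta -> boundary (V p.2) (f p.1 x).
    apply: filterS (filter_forall _ H) => -[y delta] /= {}H Ay.
    exists x => // i k.
    exact: (H (i, k)).
  case: p => i k /=.
  have cfx := (subspace_continuousP A (f i)).1 (cf i) x Ax.
  have [bx|nbx] := pselect (boundary (V k) (f i x)); first by near=> y delta.
  have [ch h0 hN] := hP k.
  have [Vx|nVx] := pselect (V k (f i x)).
    have h2 : 0 < h k (f i x) / 2 by rewrite divr_gt0// h0.
    have h2x : h k (f i x) / 2 < h k (f i x).
      by rewrite ltr_pdivrMr// ltr_pMr ?h0// ltr1n.
    near=> y delta => /= Ay /andP[_ lt_delta]; exfalso.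
    have : h k (f i x) / 2 < h k (f i y).
      move: Ay; near: y.
      exact: (cvgr_gt _ (cvg_comp _ _ cfx (ch (f i x))) _ h2x).
    rewrite ltNge => /negP; apply; apply: le_trans (ltW lt_delta) _.
    by near: delta; apply: filterS (nbhs_right_lt h2) => d /ltW.
  have ncl : (~` closure (V k)) (f i x).
    by move=> clx; apply: nbx; split=> // /interior_subset.
  near=> y delta => /= Ay /andP[hpos _]; exfalso.
  have : (~` closure (V k)) (f i y).
    move: Ay; near: y; apply: (cfx (~` closure (V k))).
    by apply: open_nbhs_nbhs; split=> //; exact/closed_openC/closed_closure.
  apply; apply: subset_closure; apply: contrapT => /hN hy.
  by move: hpos; rewrite hy ltxx.
near (0 : R)^'+ => delta.
have coverd : [set: X] `<=` [set x | exists k, delta <= h k x] by near: delta.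
have bdd : A `<=` [set y | A y ->
    exists2 x, A x & forall (i : 'I_n) (k : 'I_m),
      0 < h k (f i y) < delta -> boundary (V k) (f i x)] by near: delta.
apply: (@cover_dim_level_sets _ _ _ _ n m (fun i k => h k \o f i) delta) => //.
- move=> i k.
  apply: (@within_continuous_comp_within _ _ _ A setT (f i) (h k)) => //.
  by apply: continuous_subspaceT; case: (hP k).
- by move=> x i Ax; exact: coverd.
- move=> J; have /choice[U hU] : forall k, exists U, alpha U /\ V k `<=` U.
    by move=> k; have [U aU VU] := subV k; exists U.
  exists (A `&` \bigcap_(i in [set: 'I_n]) (f i @^-1` U (J i))).
    by exists (fun i => U (J i)) => // i; case: (hU (J i)).
  move=> x [Ax Jx]; split=> // i _; have [_ h0 hN] := hP (J i).
  have [_] := hU (J i); apply; apply: contrapT => /hN hx.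
  by have := Jx i; rewrite /= hx ltxx.
move=> y Ay; have [x Ax hx] := bdd _ Ay Ay.
apply: (@le_trans _ _
  (\sum_(k < m) \sum_(i < n) (\1_(boundary (V k)) (f i x) : R))).
  rewrite exchange_big pair_big /= -sum1_card natr_sum big_mkcond /=.
  apply: ler_sum => p _; rewrite indicE; case: ifPn => // hp.
  by rewrite mem_set//; apply: hx; move: hp; rewrite inE.
rewrite mulr_sumr; apply: ler_sum => k _.
exact: sum_orbit_le_sup_cap.
Unshelve. all: by end_near. Qed.

Lemma cover_dim_ge0 (A : set X) (alpha : set (set X)) : A !=set0 ->
  (0 <= cover_dim A alpha)%E.
Proof.
move=> [x Ax]; apply: le_ereal_inf_tmp => _ [beta [[finb [_ cb]] _] <-].
rewrite /ord leeBrDr// add0e.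
apply: (@le_trans _ _ ((\sum_(U \in beta) (\1_U x : R))%:E)); last first.
  by apply: ereal_sup_ubound; exists x.
have : (\bigcup_(U in beta) U) x by rewrite cb.
move=> [U bU Ux]; rewrite lee_fin (fsbigD1 U)//= indicE mem_set//.
by rewrite lerDl; apply: fsumr_ge0 => W _.
Qed.

End orbit_capacity.

(** * Passage to the limit in [n] *)

Lemma limn_esup_le0 (R : realType) (u : nat -> \bar R) (w : nat -> R) :
  (forall n, (u n <= (w n)%:E)%E) -> w @ \oo --> (0 : R) ->
  (limn_esup u <= 0)%E.
Proof.
move=> uw w0; apply/lee_addgt0Pr => e e0; rewrite add0e.
(* The upper limit is an infimum over sets of the filter, so one such set suffices. *)
apply: (@le_trans _ _ (ereal_sup (u @` [set n | w n <= e]))).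
  apply: ereal_inf_lbound; exists [set n | w n <= e] => //.
  by apply: filterS (cvgr_lt _ w0 _ e0) => n /ltW.
apply: ge_ereal_sup => _ [n we <-].
by apply: (le_trans (uw n)); rewrite lee_fin.
Qed.

Theorem theorem2 (R : realType) (X : metricType R) (I : Type)
    (v : I -> partial_homeo X) (compactX : compact [set: X])
    (ifs_v : is_ifs v) (sbp_v : has_SBP v) :
  mdim v = 0%E.
Proof.
suff h sigma : mdim_along v sigma = 0%E.
  (* An index gives a sequence, so the supremum is not over the empty set, where it would be -oo. *)
  have [_ [[_ [i0 _ _]] _]] := ifs_v.
  rewrite /mdim (_ : [set _ | _ in _] = [set 0%E]) ?ereal_sup1//.
  apply/seteqP; split=> [_ [s _ <-]|_ ->]; first exact: h.
  by exists (fun=> i0).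
rewrite /mdim_along; case: eqVneq => // /set0P A0.
apply/eqP; rewrite eq_le; apply/andP; split; last first.
  apply: (@le_trans _ _ (limn_esup (fun n =>
    cover_dim (Sigma_dom v sigma) (orbit_cover v sigma n [set setT]) *
    (n%:R^-1)%:E)%E)).
    apply: limf_esup_ge0; first exact: filter_not_empty.
    by move=> n; rewrite mule_ge0 ?cover_dim_ge0// lee_fin invr_ge0.
  apply: ereal_sup_ubound; exists [set setT] => //; split=> //.
  split; last by rewrite bigcup_set1.
  by move=> _ ->; split=> //; exact: openT.
apply: ge_ereal_sup => _ [alpha [_ [oalpha calpha]] <-].
have /choice[V VP] : forall x, exists V, [/\ open V, V x,
    small v (boundary V) & exists2 U, alpha U & V `<=` U].
  move=> x; have : (\bigcup_(U in alpha) U) x by rewrite calpha.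
  move=> [U aU Ux]; have oU : open U.
    have [_] := oalpha U aU; rewrite -(open_setIS U openT) setIT; exact.
  by have [V [oV VU Vx sV]] := sbp_v x U oU Ux; exists V; split=> //; exists U.
have [s hs] : exists s : seq X, forall x, exists2 t, t \in s & V t x.
  apply: compact_finite_cover => // [x|x]; first by case: (VP x).
  by exists x; case: (VP x).
pose W (k : 'I_(size s)) := V (tnth (in_tuple s) k).
pose w n := \sum_(k < size s) sup_cap v (boundary (W k)) n.
have w0 : w @ \oo --> (0 : R).
  have <- : \sum_(k < size s) (0 : R) = 0 by rewrite big1.
  apply: cvg_big => [|k _]; first exact: add_continuous.
  (* Smallness gives only the value of [limn]; convergence itself comes from the Fekete argument. *)
  have [_ _ <- _] := VP (tnth (in_tuple s) k).
  exact: is_cvg_sup_cap.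
(* The absolute value covers [n = 0], where the quotient is 0 by convention. *)
apply: (@limn_esup_le0 _ _ (fun n => `|w n|)); last first.
  by rewrite -(normr0 R); exact: cvg_norm.
move=> n.
have hn : (cover_dim (Sigma_dom v sigma) (orbit_cover v sigma n alpha) <=
    (n%:R * w n)%:E)%E.
  apply: cover_dim_orbit_cover => //.
  - by move=> k; case: (VP (tnth (in_tuple s) k)).
  - move=> x; have [t ts Vtx] := hs x.
    have /tnthP[k tk] : t \in in_tuple s by [].
    by exists k; rewrite /W -tk.
  - by move=> k; case: (VP (tnth (in_tuple s) k)).
apply: (le_trans (lee_wpmul2r _ hn)); first by rewrite lee_fin invr_ge0.
rewrite -EFinM lee_fin; case: n {hn} => [|n].
  by rewrite mul0r mul0r normr_ge0.
by rewrite mulrAC mulfV ?pnatr_eq0// mul1r ler_norm.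
Qed.
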